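(* The modal logic $\mathsf K$ is complete for finite provability models: if $A\in\mathcal L_\Box$ satisfies $\mathcal P,w\Vdash A$ for every provability model $\mathcal P$ with finitely many worlds and every world $w$ of $\mathcal P$, then $\mathsf K\vdash A$.
   Context: $\mathsf K$ is the smallest normal modal logic in $\mathcal L_\Box$. Language $\mathcal L_\Box$: formulas built from atomic propositions and $\bot$ using $\to$ and a unary $\Box$. A formula is purely modal if it is a Boolean combination of formulas of the form $\Box B$. A theory is a pair of a set of axioms and a set of inference rules (finitely many premises, one conclusion); $\mathsf T\vdash A$ means derivability from axioms by rules. A theory is classical if modus ponens is one of its rules and all classical tautologies are derivable. A provability pre-model is $\mathcal P=(W,\sqsubset,\{L_w\}_{w\in W^\sqsubset},V)$ with $W$ nonempty, $\sqsubset$ a binary relation on $W$, $V\subseteq W\times\mathrm{atoms}$, $W^\sqsubset=\{u:\exists v\,(v\sqsubset u)\}$, and a theory $L_w$ for each $w\in W^\sqsubset$. Satisfaction: atoms via $V$, $\bot$ never holds, $\to$ classical, $\mathcal P,w\Vdash\Box A$ iff $L_u\vdash A$ for all $u$ with $w\sqsubset u$. With $\sqsubset^+$ the transitive closure, $\mathcal P,w\Vdash^+A$ iff there is $u\sqsubset w$ with $\mathcal P,v\Vdash A$ for all $v$ such that $u\sqsubset^+v$. A provability model is a pre-model in which every $L_w$ is classical and which satisfies modal completeness: for every $w\in W^\sqsubset$ and purely modal $A$, $\mathcal P,w\Vdash^+A$ implies $L_w\vdash A$. *)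

(* Defs.v *)
From Stdlib Require Import List Relation_Operators FinFun.
Import ListNotations.

Set Implicit Arguments.
Unset Strict Implicit.

Section Language.

Variable atom : Type.

Inductive form : Type :=
| Var (p : atom)
| Bot
| Imp (A B : form)
| Box (A : form).

Fixpoint subst (s : atom -> form) (A : form) : form :=
  match A with
  | Var p => s p
  | Bot => Bot
  | Imp B C => Imp (subst s B) (subst s C)
  | Box B => Box (subst s B)
  end.

(* Boxed formulas are opaque here: propositionally they behave like atoms. *)
Fixpoint eval (va : atom -> bool) (vb : form -> bool) (A : form) : bool :=
  match A with
  | Var p => va p
  | Bot => false
  | Imp B C => implb (eval va vb B) (eval va vb C)
  | Box B => vb B
  end.

Definition tautology (A : form) : Prop :=
  forall va vb, eval va vb A = true.

Inductive purely_modal : form -> Prop :=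
| pm_Box B : purely_modal (Box B)
| pm_Bot : purely_modal Bot
| pm_Imp A B : purely_modal A -> purely_modal B -> purely_modal (Imp A B).

Record normal_logic (L : form -> Prop) : Prop := {
  normal_taut : forall A, tautology A -> L A;
  normal_K : forall A B, L (Imp (Box (Imp A B)) (Imp (Box A) (Box B)));
  normal_mp : forall A B, L A -> L (Imp A B) -> L B;
  normal_nec : forall A, L A -> L (Box A);
  normal_subst : forall s A, L A -> L (subst s A)
}.

Definition logicK (A : form) : Prop :=
  forall L : form -> Prop, normal_logic L -> L A.

(* A rule is given by its instances: [r ps A] says that [r] allows one to infer
   [A] from the finite list of premises [ps]. *)
Definition rule : Type := list form -> form -> Prop.

Definition modus_ponens : rule :=
  fun ps C => exists B, ps = [B; Imp B C].

Record theory : Type := Theory {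
  axioms : form -> Prop;
  rules : rule -> Prop
}.

Inductive derives (T : theory) : form -> Prop :=
| derives_axiom A : axioms T A -> derives T A
| derives_rule (r : rule) ps A :
    rules T r -> r ps A -> (forall B, In B ps -> derives T B) -> derives T A.

Definition classical (T : theory) : Prop :=
  rules T modus_ponens /\ forall A, tautology A -> derives T A.

Definition has_pred (W : Type) (R : W -> W -> Prop) (u : W) : Prop :=
  exists v, R v u.

Record premodel : Type := Premodel {
  world : Type;
  world_inhabited : inhabited world;
  acc : world -> world -> Prop;
  local : {u : world | has_pred acc u} -> theory;
  val : world -> atom -> Prop
}.

Fixpoint sat (P : premodel) (w : world P) (A : form) : Prop :=
  match A with
  | Var p => val w p
  | Bot => False
  | Imp B C => sat w B -> sat w C
  | Box B => forall u : {u : world P | has_pred (@acc P) u},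
      acc w (proj1_sig u) -> derives (local u) B
  end.

Definition sat_plus (P : premodel) (w : world P) (A : form) : Prop :=
  exists u, acc u w /\
    forall v, clos_trans (world P) (@acc P) u v -> sat v A.

Record provability_model (P : premodel) : Prop := {
  local_classical :
    forall w : {w : world P | has_pred (@acc P) w}, classical (local w);
  modal_completeness :
    forall (w : {w : world P | has_pred (@acc P) w}) (A : form),
      purely_modal A -> sat_plus (proj1_sig w) A -> derives (local w) A
}.

End Language.

Arguments Bot {atom}.

(* Main.v *)
(** A Kripke model becomes a provability model if each local theory consists of
    the formulas true at its world: provability at a world is then truth there,
    so the two notions of satisfaction agree, and modal completeness is
    immediate because accessibility is contained in its transitive closure.
    Completeness for finite provability models thus reduces to the finite model
    property of K.  For the latter, the worlds are all assignments of truth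
    values to the subformulas of the given formula; only K-consistent
    assignments are accessible, and the truth lemma is claimed at consistent
    assignments only. *)

Require Import Defs.
From Stdlib Require Import FinFun List Classical ClassicalEpsilon.
From Stdlib Require Import Relation_Operators.
Import ListNotations.

Set Implicit Arguments.
Unset Strict Implicit.

(** * Kripke models as provability models *)

Section KripkeProvability.

Variables (atom W : Type) (R : W -> W -> Prop) (V : W -> atom -> Prop).

Fixpoint kripke_sat (w : W) (A : form atom) : Prop :=
  match A with
  | Var p => V w p
  | Bot => False
  | Imp B C => kripke_sat w B -> kripke_sat w C
  | Box B => forall u, R w u -> kripke_sat u B
  end.

(** The axioms already exhaust the truths at [w]; modus ponens is there because a classical theory
    must have it as a rule, and it preserves truth at a world. *)
Definition truth_theory (w : W) : theory atom :=
  Theory (kripke_sat w) (eq (@modus_ponens atom)).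

Lemma derives_truth_theory w A : derives (truth_theory w) A <-> kripke_sat w A.
Proof.
split; [|now intros; apply derives_axiom].
induction 1 as [A HA | r ps A Hr HrA _ IH]; [exact HA|].
simpl in Hr; subst r; destruct HrA as [B ->].
apply (IH (Imp B A)); [simpl; auto|].
apply IH; simpl; auto.
Qed.

Lemma kripke_sat_tautology w A : tautology A -> kripke_sat w A.
Proof.
(* [eval] is Boolean-valued, so Kripke truth is turned into a Boolean valuation by excluded middle,
   with boxed formulas valued like atoms. *)
pose (truth (P : Prop) := if excluded_middle_informative P then true else false).
assert (truthE : forall P, truth P = true <-> P).
{ intros P; unfold truth.
  destruct (excluded_middle_informative P); intuition discriminate. }
intros HA.
enough (evalE : forall B, eval (fun p => truth (V w p))
                  (fun B => truth (kripke_sat w (Box B))) B = true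
                <-> kripke_sat w B) by apply evalE, HA.
induction B as [p| |B IHB C IHC|B _].
- apply truthE.
- simpl; intuition discriminate.
- simpl; rewrite <- IHB, <- IHC.
  do 2 destruct (eval _ _ _); simpl; intuition discriminate.
- apply truthE.
Qed.

Lemma truth_theory_classical w : classical (truth_theory w).
Proof.
split; [reflexivity|].
intros A HA; apply derives_truth_theory, kripke_sat_tautology, HA.
Qed.

Variable (W_inhabited : inhabited W).

Definition kripke_premodel : premodel atom :=
  @Premodel atom W W_inhabited R (fun u => truth_theory (proj1_sig u)) V.

Lemma sat_kripke_premodel A (w : W) :
  sat (P := kripke_premodel) w A <-> kripke_sat w A.
Proof.
revert w; induction A as [p| |B IHB C IHC|B IHB]; intros w; simpl.
- tauto.
- tauto.
- now rewrite IHB, IHC.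
- split.
  + intros H u wu.
    (* The world [u] carries a local theory because [w] precedes it. *)
    exact (proj1 (derives_truth_theory _ _) (H (exist _ u (ex_intro _ w wu)) wu)).
  + intros H [u Hu] wu; apply derives_truth_theory, H, wu.
Qed.

Lemma kripke_provability_model : provability_model kripke_premodel.
Proof.
split.
- intros w; apply truth_theory_classical.
- intros w A _ [u [uw Hu]].
  apply derives_truth_theory, sat_kripke_premodel, Hu, t_step, uw.
Qed.

End KripkeProvability.

(** * Derivability in K from finitely many premises *)

Section Entailment.

Variable atom : Type.
Notation form := (form atom).
Implicit Types (A B C : form) (G D l : list form).

Lemma logicK_taut A : tautology A -> logicK A.
Proof. intros HA L HL; exact (normal_taut HL HA). Qed.

Lemma logicK_dist A B : logicK (Imp (Box (Imp A B)) (Imp (Box A) (Box B))).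
Proof. intros L HL; exact (normal_K HL A B). Qed.

Lemma logicK_mp A B : logicK A -> logicK (Imp A B) -> logicK B.
Proof. intros HA HAB L HL; exact (normal_mp HL (HA L HL) (HAB L HL)). Qed.

Lemma logicK_nec A : logicK A -> logicK (Box A).
Proof. intros HA L HL; exact (normal_nec HL (HA L HL)). Qed.

Definition imps G A : form := fold_right (@Imp atom) A G.

Definition neg A : form := Imp A Bot.

(** Premises are internalised as nested implications, so necessitation never applies to them. *)
Definition entails G A : Prop := logicK (imps G A).

Definition consistent G : Prop := ~ entails G Bot.

Lemma eval_imps va vb G A :
  eval va vb (imps G A) = true <->
  ((forall B, In B G -> eval va vb B = true) -> eval va vb A = true).
Proof.
induction G as [|B G IH]; simpl.
- intuition.
- destruct (eval va vb B) eqn:EB; simpl.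
  + rewrite IH; split; intros H HG; apply H; intros C HC; [auto|].
    destruct HC as [<-|]; auto.
  + split; [|reflexivity]; intros _ H.
    rewrite (H B (or_introl eq_refl)) in EB; discriminate.
Qed.

Lemma entails_taut G A :
  (forall va vb, (forall B, In B G -> eval va vb B = true) ->
     eval va vb A = true) ->
  entails G A.
Proof. intros H; apply logicK_taut; intros va vb; apply eval_imps, H. Qed.

(** The premise [A] is outermost on the left but has to become innermost; moving it past [G] is a
    tautology. *)
Lemma entails_intro G A B : entails (A :: G) B -> entails G (Imp A B).
Proof.
intros H; apply (logicK_mp H), logicK_taut; intros va vb.
change (implb (eval va vb (imps (A :: G) B))
          (eval va vb (imps G (Imp A B))) = true).
destruct (eval va vb (imps (A :: G) B)) eqn:E; [|reflexivity].
rewrite eval_imps in E; simpl; apply eval_imps; intros HG; simpl.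
destruct (eval va vb A) eqn:EA; [|reflexivity]; apply E.
intros C [<-|HC]; auto.
Qed.

(** Cut, by induction on [D]: its head moves into the conclusion, the induction hypothesis cuts the
    tail, and modus ponens under [G] discharges the head. *)
Lemma entails_trans G D A :
  (forall B, In B D -> entails G B) -> entails D A -> entails G A.
Proof.
revert A; induction D as [|B D IH]; intros A HD HA.
- apply (logicK_mp HA), logicK_taut; intros va vb; simpl.
  destruct (eval va vb A) eqn:EA; [|reflexivity]; simpl.
  now apply eval_imps; intros _.
- assert (HBA : entails G (Imp B A)).
  { apply IH; [intros C HC; apply HD; simpl; auto|].
    apply entails_intro, HA. }
  apply (logicK_mp HBA); refine (logicK_mp (HD B (or_introl eq_refl)) _).
  apply logicK_taut; intros va vb.
  change (implb (eval va vb (imps G B)) (implb (eval va vb (imps G (Imp B A)))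
            (eval va vb (imps G A))) = true).
  destruct (eval va vb (imps G B)) eqn:E1; [|reflexivity].
  destruct (eval va vb (imps G (Imp B A))) eqn:E2; [|reflexivity].
  rewrite eval_imps in E1, E2; simpl; apply eval_imps; intros HG.
  specialize (E2 HG); simpl in E2; rewrite (E1 HG) in E2; exact E2.
Qed.

Lemma entails_in G A : In A G -> entails G A.
Proof. intros HA; apply entails_taut; auto. Qed.

Lemma entails_incl G D A : incl G D -> entails G A -> entails D A.
Proof. intros GD; apply entails_trans; intros B HB; apply entails_in, GD, HB. Qed.

Lemma entails_mp G A B : entails G (Imp A B) -> entails G A -> entails G B.
Proof.
intros HAB HA; apply entails_trans with (D := [Imp A B; A]).
- intros C [<-|[<-|[]]]; assumption.
- apply entails_taut; intros va vb H.
  generalize (H _ (or_introl eq_refl)); simpl.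
  rewrite (H A (or_intror (or_introl eq_refl))); auto.
Qed.

Lemma entails_neg_elim G A : entails (neg A :: G) Bot -> entails G A.
Proof.
intros H; apply entails_trans with (D := [neg (neg A)]).
- intros C [<-|[]]; apply entails_intro, H.
- apply entails_taut; intros va vb HA.
  generalize (HA _ (or_introl eq_refl)); simpl; now destruct (eval va vb A).
Qed.

(** The empty list is necessitation; each further premise moves into the conclusion, is boxed with
    it, and comes back by the distribution axiom. *)
Lemma entails_box G A : entails G A -> entails (map (@Box atom) G) (Box A).
Proof.
revert A; induction G as [|B G IH]; intros A H.
- apply logicK_nec, H.
- simpl.
  apply entails_mp with (A := Box B); [|apply entails_in; simpl; auto].
  apply entails_mp with (A := Box (Imp B A)).
  + apply (@entails_incl []); [intros ? []|apply logicK_dist].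
  + apply (entails_incl (incl_tl _ (incl_refl _))), IH, entails_intro, H.
Qed.

Lemma consistent_incl G D : incl G D -> consistent D -> consistent G.
Proof. intros GD HD HG; apply HD, (entails_incl GD HG). Qed.

Lemma consistent_not_both G A : consistent G -> In A G -> ~ In (neg A) G.
Proof.
intros HG HA HnA; apply HG, entails_mp with (A := A); apply entails_in; auto.
Qed.

(** * Truth assignments and Lindenbaum's lemma *)

Fixpoint assignment l : Type :=
  match l with
  | [] => unit
  | _ :: l => (bool * assignment l)%type
  end.

(** Signs belong to positions of [l], so a formula listed twice may occur with both signs;
    consistency rules such assignments out. *)
Fixpoint literals l : assignment l -> list form :=
  match l with
  | [] => fun _ => []
  | A :: l => fun a => (if fst a then A else neg A) :: literals (snd a)
  end.

Lemma assignment_finite l : Finite (assignment l).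
Proof.
induction l as [|A l [s Hs]]; simpl.
- exists [tt]; intros []; simpl; auto.
- exists (list_prod [true; false] s).
  intros [b a]; apply in_prod; [destruct b; simpl; auto|apply Hs].
Qed.

Lemma literals_decide l (a : assignment l) A :
  In A l -> In A (literals a) \/ In (neg A) (literals a).
Proof.
induction l as [|B l IH]; simpl; [intros []|].
intros [->|HA]; [destruct (fst a); auto|].
destruct (IH (snd a) HA); auto.
Qed.

(** A negative literal is an implication, so a boxed literal must be positive. *)
Lemma literals_box l (a : assignment l) A :
  In (Box A) (literals a) -> In (Box A) l.
Proof.
induction l as [|B l IH]; simpl; [intros []|].
intros [HB|HA]; [|right; exact (IH _ HA)].
destruct (fst a); [auto|discriminate].
Qed.

Lemma lindenbaum l G :
  consistent G -> exists a : assignment l, consistent (literals a ++ G).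
Proof.
intros HG; induction l as [|A l [a Ha]]; [exists tt; exact HG|].
destruct (classic (consistent (A :: literals a ++ G))) as [HA|HA].
- exists (true, a); exact HA.
(* If both signs of [A] were inconsistent, [literals a ++ G] would entail [neg A] and [A]. *)
- exists (false, a); intros HnA; apply HA; intros HA'; apply Ha.
  apply entails_mp with (A := A); [apply entails_intro, HA'|].
  apply entails_neg_elim, HnA.
Qed.

(** * The finite canonical model over subformulas *)

Definition unbox G : list form :=
  flat_map (fun A => match A with Box B => [B] | _ => [] end) G.

Lemma in_unbox G A : In A (unbox G) <-> In (Box A) G.
Proof.
unfold unbox; rewrite in_flat_map; split.
- intros [[p| |B C|B] [HB HA]]; simpl in HA; try tauto.
  destruct HA as [<-|[]]; exact HB.
- intros HA; exists (Box A); simpl; auto.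
Qed.

(** Provides the seed of a successor refuting [A]: otherwise [unbox G] would entail [A], and boxing
    this would make [G] entail [Box A]. *)
Lemma consistent_unbox G A :
  consistent G -> In (neg (Box A)) G -> consistent (neg A :: unbox G).
Proof.
intros HG HA H; apply HG.
apply entails_mp with (A := Box A); [apply entails_in, HA|].
apply entails_incl with (G := map (@Box atom) (unbox G)).
- intros B HB; apply in_map_iff in HB; destruct HB as [C [<- HC]].
  apply in_unbox, HC.
- apply entails_box, entails_neg_elim, H.
Qed.

Fixpoint subformulas A : list form :=
  A :: match A with
       | Imp B C => subformulas B ++ subformulas C
       | Box B => subformulas B
       | _ => []
       end.

Lemma subformulas_refl A : In A (subformulas A).
Proof. destruct A; simpl; auto. Qed.

Lemma subformulas_trans A B : In B (subformulas A) ->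
  incl (subformulas B) (subformulas A).
Proof.
induction A as [p| |C IHC D IHD|C IHC]; intros [<-|HB];
  try apply incl_refl; try (destruct HB; fail).
- apply incl_tl; apply in_app_or in HB; destruct HB.
  + apply incl_appl; auto.
  + apply incl_appr; auto.
- apply incl_tl; auto.
Qed.

Variable A0 : form.
Notation W := (assignment (subformulas A0)).

(** Canonical accessibility. Consistency sits in the relation rather than in the type of worlds,
    which keeps finiteness immediate. *)
Definition fin_acc (w v : W) : Prop :=
  consistent (literals v) /\ incl (unbox (literals w)) (literals v).

Definition fin_val (w : W) (p : atom) : Prop := In (Var p) (literals w).

Lemma truth_lemma A (w : W) :
  In A (subformulas A0) -> consistent (literals w) ->
  kripke_sat fin_acc fin_val w A <-> In A (literals w).
Proof.
revert w; induction A as [p| |B IHB C IHC|B IHB]; intros w HA Hw;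
  assert (Hsub := subformulas_trans HA); simpl in Hsub.
- reflexivity.
- split; [intros []|intros HB; apply Hw, entails_in, HB].
- assert (HB : In B (subformulas A0)).
  { apply Hsub; right; apply in_or_app; left; apply subformulas_refl. }
  assert (HC : In C (subformulas A0)).
  { apply Hsub; right; apply in_or_app; right; apply subformulas_refl. }
  simpl; rewrite (IHB w HB Hw), (IHC w HC Hw); split.
  + intros HBC; destruct (literals_decide w HA) as [|HnBC]; [assumption|].
    (* It remains to entail [Imp B C]: from [C] when [B] is a literal, from [neg B] otherwise. *)
    exfalso; apply Hw, (entails_mp (entails_in HnBC)).
    destruct (literals_decide w HB) as [HBw|HBw].
    * apply entails_trans with (D := [C]).
      -- intros D [<-|[]]; apply entails_in; auto.
      -- apply entails_taut; intros va vb H; simpl.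
         rewrite (H C (or_introl eq_refl)); now destruct (eval va vb B).
    * apply entails_trans with (D := [neg B]).
      -- intros D [<-|[]]; apply entails_in; auto.
      -- apply entails_taut; intros va vb H.
         generalize (H _ (or_introl eq_refl)); simpl.
         now destruct (eval va vb B).
  + intros HBC HBw; destruct (literals_decide w HC) as [|HnC]; [assumption|].
    exfalso; apply Hw, (entails_mp (entails_in HnC)).
    apply (entails_mp (entails_in HBC)), entails_in, HBw.
- assert (HB : In B (subformulas A0)).
  { apply Hsub; right; apply subformulas_refl. }
  simpl; split.
  + intros H; destruct (literals_decide w HA) as [|HnB]; [assumption|exfalso].
    (* The world [v] is a successor refuting [B]; [Hv] keeps the seed next to its literals, so no
       literal can contradict the seed. *)
    destruct (lindenbaum (subformulas A0) (consistent_unbox Hw HnB)) as [v Hv].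
    assert (Hv' : consistent (literals v)).
    { apply (consistent_incl (incl_appl _ (incl_refl _)) Hv). }
    apply (consistent_not_both Hv (A := B)); apply in_or_app;
      [left|right; simpl; auto].
    apply IHB; [assumption..|]; apply H; split; [assumption|].
    intros C HC.
    (* [v] decides only subformulas of [A0]; [C] is one since [Box C] is a literal of [w]. *)
    assert (HC0 : In C (subformulas A0)).
    { apply in_unbox, literals_box, subformulas_trans in HC.
      apply HC; right; apply subformulas_refl. }
    destruct (literals_decide v HC0) as [|HnC]; [assumption|exfalso].
    apply (consistent_not_both Hv (A := C)); apply in_or_app; simpl; auto.
  + intros HBw v [Hv wv]; apply IHB; [assumption..|].
    apply wv, in_unbox, HBw.
Qed.

End Entailment.

Theorem theorem3p7 (atom : Type) (A : form atom) :
  (forall P : premodel atom,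
     provability_model P -> Finite (world P) -> forall w : world P, sat w A) ->
  logicK A.
Proof.
intros H; apply NNPP; intros HA.
assert (HnA : consistent [neg A]).
{ intros HnA; apply HA, (entails_neg_elim HnA). }
(* At [w] the validity of [A] makes [A] a literal by the truth lemma, against the seed [neg A]. *)
destruct (lindenbaum (subformulas A) HnA) as [w Hw].
apply (consistent_not_both Hw (A := A)); apply in_or_app; [left|simpl; auto].
apply truth_lemma.
- apply subformulas_refl.
- apply (consistent_incl (incl_appl _ (incl_refl _)) Hw).
- apply (sat_kripke_premodel _ _ (inhabits w)), H.
  + apply kripke_provability_model.
  + apply assignment_finite.
Qed.
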